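(* Let $\mathfrak{B}$ be a bornology with a compact base on a Tychonoff space $X$. The following are equivalent. (1) $X$ satisfies $S_{fin}(\mathcal{O}_{\mathfrak{B}},\mathcal{O}_{\mathfrak{B}})$. (2) $C_{\mathfrak{B}}(X)$ has countable fan tightness. (3) $C_{\mathfrak{B}}(X)$ has countable fan tightness for finite sets.
   Context: A bornology $\mathfrak{B}$ on $X$ is a family of subsets of $X$ that is closed under taking subsets and finite unions and covers $X$; by standing convention $X\notin\mathfrak{B}$. A base of $\mathfrak{B}$ is a subfamily $\mathfrak{B}_0\subseteq\mathfrak{B}$ such that every $B\in\mathfrak{B}$ is contained in some $B_0\in\mathfrak{B}_0$; it is compact if its members are compact. $\mathcal{O}_{\mathfrak{B}}$ is the collection of all open $\mathfrak{B}$-covers of $X$: families $\mathcal{U}$ of open subsets of $X$ with $X\notin\mathcal{U}$ such that every $B\in\mathfrak{B}$ is contained in some $U\in\mathcal{U}$. $S_{fin}(\mathcal{A},\mathcal{B})$ means that for each sequence $\{\mathcal{U}_n:n\in\omega\}$ of elements of $\mathcal{A}$ there are finite (possibly empty) $\mathcal{V}_n\subseteq\mathcal{U}_n$ with $\bigcup_{n\in\omega}\mathcal{V}_n\in\mathcal{B}$. $C_{\mathfrak{B}}(X)$ is the set $C(X)$ of continuous real-valued functions on $X$ with the topology of uniform convergence on $\mathfrak{B}$, in which the sets $\{g\in C(X):|f(x)-g(x)|<\varepsilon\ \forall x\in B\}$ ($B\in\mathfrak{B}$, $\varepsilon>0$) form a neighbourhood base at $f$. For a space $Y$ and $y\in Y$,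 let $\Omega_y=\{C\subseteq Y:y\in\overline{C}\setminus C\}$. $Y$ has countable fan tightness if for every $y\in Y$ it satisfies $S_{fin}(\Omega_y,\Omega_y)$. A family $\mathcal{C}$ of nonempty subsets of $Y$ is a $\pi$-network at $y$ if each neighbourhood of $y$ contains some member of $\mathcal{C}$. $Y$ has countable fan tightness for finite sets if for each $y\in Y$ and each sequence $\{\mathcal{C}_n:n\in\omega\}$ of $\pi$-networks at $y$ consisting of finite subsets of $Y$ there are finite $\mathcal{D}_n\subseteq\mathcal{C}_n$ such that $\bigcup_{n\in\omega}\mathcal{D}_n$ is a $\pi$-network at $y$. *)

(* Defs.v *)
From HB Require Import structures.
From mathcomp Require Import all_boot all_order all_algebra.
From mathcomp Require Import all_classical all_reals all_analysis.

Set Implicit Arguments.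
Unset Strict Implicit.
Unset Printing Implicit Defensive.

Import Order.TTheory GRing.Theory Num.Theory.
Import numFieldNormedType.Exports.
Local Open Scope classical_set_scope.
Local Open Scope ring_scope.

(* [completely_regular_space] is phrased with separating uniformities; lemma
   [uniform_separatorP] is its form with continuous functions into [0, 1]. *)
Definition tychonoff_space (X : topologicalType) : Prop :=
  accessible_space X /\ completely_regular_space X.

(* [set0] is a member as soon as the bornology is nonempty, in particular
   whenever [X] is nonempty. *)
Record bornology (X : Type) (B : set (set X)) : Prop := Bornology {
  bornology_sub : forall A C : set X, A `<=` C -> B C -> B A ;
  bornologyU : forall A C : set X, B A -> B C -> B (A `|` C) ;
  bornology_cover : \bigcup_(A in B) A = [set: X] ;
  bornologyNT : ~ B [set: X] }.

Definition bornology_base (X : Type) (B B0 : set (set X)) : Prop :=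
  B0 `<=` B /\ forall A, B A -> exists2 A0, B0 A0 & A `<=` A0.

Definition has_compact_base (X : topologicalType) (B : set (set X)) : Prop :=
  exists2 B0, bornology_base B B0 & B0 `<=` compact.

Definition open_bcovers (X : topologicalType) (B : set (set X)) :
    set (set (set X)) :=
  [set U | [/\ U `<=` open, ~ U [set: X] &
               forall A, B A -> exists2 V, U V & A `<=` V]].

Definition S_fin (T : Type) (P Q : set (set T)) : Prop :=
  forall U : nat -> set T, (forall n, P (U n)) ->
  exists V : nat -> set T,
    (forall n, finite_set (V n) /\ V n `<=` U n) /\ Q (\bigcup_n V n).

(* The subspace of continuous functions of [{family B, X -> R}]. *)
Definition CB (R : realType) (X : topologicalType) (B : set (set X)) : Type :=
  continuousType X R.

HB.instance Definition _ (R : realType) (X : topologicalType)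
    (B : set (set X)) :=
  Uniform.copy (CB R B)
    (initial_topology (id : continuousType X R -> {family B, X -> R})).

Definition Omega_at (Y : topologicalType) (y : Y) : set (set Y) :=
  [set C | (closure C `\` C) y].

Definition countable_fan_tightness (Y : topologicalType) : Prop :=
  forall y : Y, S_fin (Omega_at y) (Omega_at y).

Definition pi_network (Y : topologicalType) (y : Y) (C : set (set Y)) : Prop :=
  (forall F, C F -> F !=set0) /\
  (forall N, nbhs y N -> exists2 F, C F & F `<=` N).

Definition countable_fan_tightness_finite_sets (Y : topologicalType) : Prop :=
  forall y : Y,
    S_fin [set C | pi_network y C /\ C `<=` finite_set] [set C | pi_network y C].

(* Agreement of the topology of [CB] with the neighbourhood base that usually
   defines uniform convergence on a bornology. *)
Lemma CB_nbhsP (R : realType) (X : topologicalType) (B : set (set X))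
    (f : CB R B) (P : set (CB R B)) :
  bornology B -> [set: X] !=set0 ->
  nbhs f P <-> exists A (e : R), [/\ B A, 0 < e &
    [set g : CB R B | forall x, A x ->
       `|(f : continuousType X R) x - (g : continuousType X R) x| < e] `<=` P].
Proof.
move=> bB [x0 _]; split; last first.
  move=> [A [e [BA e0 sP]]].
  apply: (filterS sP).
  have cid : continuous (id : CB R B -> {family B, X -> R}).
    exact: initial_continuous.
  have := @fam_nbhs X R B A [set xy | ball xy.1 e xy.2]
    ((f : continuousType X R) : X -> R) (entourage_ball _ (PosNum e0)) BA.
  exact: cid.
have B0 : B set0.
  have : (\bigcup_(A in B) A) x0 by rewrite (bornology_cover bB).
  by move=> [A BA _]; apply: (bornology_sub bB _ BA).
pose base (h : X -> R) := filter_from [set Ae : set X * R | B Ae.1 /\ 0 < Ae.2]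
  (fun Ae => [set g : X -> R | forall x, Ae.1 x -> `|h x - g x| < Ae.2]).
have Fbase h : Filter (base h).
  apply: filter_from_filter; first by exists (set0, 1); split.
  move=> [A e] [A' e'] /= [BA e0] [BA' e0'].
  exists (A `|` A', Num.min e e') => /=.
    by split; [exact: bornologyU | rewrite lt_min e0].
  by move=> g /= H; split=> x Ax; have := H x; rewrite lt_min;
    move=> /(_ (or_introl Ax)) || move=> /(_ (or_intror Ax)); case/andP.
have cvgb : {family B, base (f : continuousType X R) -->
                       ((f : continuousType X R) : X -> R)}.
  apply/fam_cvgP => A BA Q /uniform_nbhs [E [entE sQ]].
  move: entE; rewrite -entourage_ballE => -[e /= e0 eE].
  exists (A, e) => //= g Hg; apply: sQ => /= x Ax; apply: eE => /=.
  by rewrite -ball_normE; exact: Hg.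
move=> [W [[V oV <-] Vf VP]].
have : base (f : continuousType X R) V by apply: cvgb; exact: open_nbhs_nbhs.
move=> [[A e] /= [BA e0] sV]; exists A, e; split=> // g Hg.
by apply: VP; exact: sV.
Qed.

(* Main.v *)
Require Import Defs.
From mathcomp Require Import all_boot all_order all_algebra.
From mathcomp Require Import all_classical all_reals all_analysis.

(** Covers of [X] and sets of functions near a given function are traded for
    one another.  A finite set [F] of continuous functions determines the open
    set of points where all members of [F] are [n.+1%:R^-1]-close to [f], and
    this set contains [A] exactly when [F] lies in the basic neighbourhood of
    [f] given by [A] and [n.+1%:R^-1].  So a [pi]-network of finite sets at [f]
    yields for each [n] a family of open sets that swallows every bounded set,
    and a selection of these open sets lifts to a selection of finite sets
    ([finite_fan_tightness_of_Sfin_bcovers]).  Two points need care.  The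
    radius depends on [n], so a selected family has to cover using arbitrarily
    late indices only; this holds because adding to a bounded set one point
    outside each of finitely many proper sets keeps it bounded and makes those
    sets useless ([bcover_tail]).  And a member of the family may be all of
    [X], which a [B]-cover excludes; if this happens for infinitely many [n],
    the corresponding finite sets converge uniformly to [f] and already form
    a [pi]-network.

    Fan tightness is the case of singletons ([fan_tightness_of_finite_sets]).

    Conversely, a cover [U n] is encoded by the set of functions equal to [1]
    off some member of [U n].  The compact base and complete regularity provide
    such functions that are small on a given bounded set
    ([compact_open_bump]), so the zero function is in the closure; and a
    function of this set that stays below [1] on [A] witnesses that [A] is inside
    the open set it encodes ([Sfin_bcovers_of_fan_tightness]).

    The empty space is treated apart: its only bornology in the present sense
    has no member at all, so the usual neighbourhood base is not one. *)

Set Implicit Arguments.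
Unset Strict Implicit.
Unset Printing Implicit Defensive.

Import Order.TTheory GRing.Theory Num.Theory.
Import numFieldNormedType.Exports.
Local Open Scope classical_set_scope.
Local Open Scope ring_scope.

(** * Compact sets and bump functions *)

(** Compactness as an induction principle: a property that is inherited by
    subsets and finite unions passes from small neighbourhoods to the compact
    set.  If it failed, the complements in [K] would generate a proper filter,
    and a cluster point in [K] contradicts the local hypothesis. *)
Lemma compact_ideal (X : topologicalType) (I : set (set X)) (K : set X) :
  I set0 -> (forall A C, A `<=` C -> I C -> I A) ->
  (forall A C, I A -> I C -> I (A `|` C)) ->
  compact K -> (forall x, K x -> exists2 N, nbhs x N & I N) -> I K.
Proof.
move=> I0 Isub IU cK locI; apply: contrapT => nIK.
pose F := [set S | I (K `\` S)].
have FF : ProperFilter F.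
  apply: Build_ProperFilter_ex.
    move=> S FS; apply: contrapT => /set0P/negP/negPn/eqP S0.
    by apply: nIK; move: FS; rewrite /F /= S0 setD0.
  split; first by rewrite /F /= setDT.
  - by move=> S T; rewrite /F /= setDIr; exact: IU.
  - by move=> S T ST; apply: Isub => x [Kx nTx]; split=> // /ST.
have [x [Kx clx]] : K `&` cluster F !=set0.
  by apply: cK; rewrite /F /= setDv.
have [N xN IN] := locI x Kx.
have [|y [nNy Ny]] := clx (~` N) N _ xN; last exact: nNy.
by apply: Isub IN => y [_ /contrapT].
Qed.

(** Complete regularity separates points from the closed set [~` U].  The sets
    on which some function with the required values is below [e] are closed
    under finite unions, since the product of two functions into [[0, 1]] is
    below both; hence [compact_ideal] applies.  Asking for values below [e]
    rather than for zeros on [K] is what makes the sets locally available: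
    the function separating a point is only small near that point. *)
Lemma compact_open_bump (R : realType) (X : topologicalType) (K U : set X)
    (e : R) :
  completely_regular_space X -> compact K -> open U -> K `<=` U -> 0 < e ->
  exists g : X -> R, [/\ continuous g, forall x, 0 <= g x <= 1,
    forall x, K x -> g x < e & forall x, ~ U x -> g x = 1].
Proof.
move=> crX cK oU KU e0.
pose I := [set S : set X | exists g : X -> R, [/\ continuous g,
  forall x, 0 <= g x <= 1, forall x, S x -> g x < e &
  forall x, ~ U x -> g x = 1]].
apply: (@compact_ideal _ I) => //.
- exists (cst 1); split=> //; first by move=> x; exact: cvg_cst.
  by move=> x; rewrite /cst /= ler01 lexx.
- move=> A C AC [g [cg g01 ge g1]]; exists g; split=> // x /AC; exact: ge.
- move=> A C [g [cg g01 ge g1]] [h [ch h01 he h1]].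
  exists (fun x => g x * h x); split.
  + by move=> x; apply: cvgM; [exact: cg|exact: ch].
  + move=> x; have /andP[g0 g1'] := g01 x; have /andP[h0 h1'] := h01 x.
    by rewrite mulr_ge0//= mulr_ile1.
  + move=> x; have /andP[g0 g1'] := g01 x; have /andP[h0 h1'] := h01 x.
    move=> [/ge|/he]; apply: le_lt_trans; first by rewrite ler_piMr.
    by rewrite ler_piMl.
  + by move=> x nUx; rewrite g1// h1// mulr1.
- move=> x /KU Ux.
  have /(@uniform_separatorP _ R)[g [cg g01 gx gU]] :
      uniform_separator [set x] (~` U).
    by apply: crX => //; rewrite closedC.
  exists [set y | g y < e].
    have gx0 : g x = 0 by apply: gx; exists x.
    by apply: (cg x [set r | r < e]); rewrite gx0; exact: lt_nbhsl.
  exists g; split=> //.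
  + by move=> y; have := g01 (g y); rewrite /= in_itv /=; apply; exists y.
  + by move=> y nUy; apply: gU; exists y.
Qed.

(** * Covers of a bornology *)

(** Enlarge [A] by a bounded set reaching outside each member of [V]: a member
    of [U] containing the enlarged set cannot be in [V].  This is where
    [X] itself must not belong to the cover. *)
Lemma bcover_unused (X : topologicalType) (B U V : set (set X)) (A : set X) :
  bornology B -> open_bcovers B U -> finite_set V -> V `<=` U -> B A ->
  exists W, [/\ U W, ~ V W & A `<=` W].
Proof.
move=> bB [_ UT Ucov] fV VU BA.
suff [A' [BA' AA' nA']] : exists A', [/\ B A', A `<=` A' &
    forall W, V W -> ~ A' `<=` W].
  have [W UW A'W] := Ucov _ BA'; exists W; split=> //.
  - by move=> /nA'; exact.
  - exact: subset_trans A'W.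
have {VU} : forall W, V W -> W != [set: X].
  by move=> W /VU UW; apply/eqP => WT; apply: UT; rewrite -WT.
case/finite_seqP: fV => s ->.
elim: s => [|W s IH] sT; first by exists A; split.
have [W' sW'|A' [BA' AA' nA']] := IH.
  by apply: sT; rewrite /= inE sW' orbT.
have [x nWx] : exists x, ~ W x.
  apply: contrapT => /forallNP H; have /negP := sT W (mem_head _ _); apply.
  by apply/eqP/seteqP; split=> // x _; apply: contrapT; exact: H.
have [C BC Cx] : (\bigcup_(C in B) C) x by rewrite (bornology_cover bB).
exists (A' `|` C); split.
- exact: bornologyU.
- by move=> y /AA'; left.
- move=> W'; rewrite /= inE => /orP[/eqP -> H|sW' H].
    by apply/nWx/H; right.
  by apply: (nA' W') => // y A'y; apply: H; left.
Qed.

(** Every tail of a countable union of finite families remains a cover, because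
    [bcover_unused] discards the finite family of the first [M] stages. *)
Lemma bcover_tail (X : topologicalType) (B : set (set X))
    (V : nat -> set (set X)) (A : set X) (M : nat) :
  bornology B -> (forall n, finite_set (V n)) ->
  open_bcovers B (\bigcup_n V n) -> B A ->
  exists n W, [/\ (M <= n)%N, V n W & A `<=` W].
Proof.
move=> bB fV cV BA.
have [||W [[n _ VnW] nW AW]] :=
    @bcover_unused _ _ _ (\bigcup_(n in `I_M) V n) A bB cV _ _ BA.
- by apply: bigcup_finite; [exact: finite_II|move=> n _; exact: fV].
- by move=> W [n _ VW]; exists n.
exists n, W; split=> //; rewrite leqNgt; apply/negP => nM.
by apply: nW; exists n.
Qed.

(** * The three implications *)

(** A point is in the closure of [C] iff the singletons of [C] form
    a [pi]-network at that point, and a selection of singletons is a selection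
    of points. *)
Lemma fan_tightness_of_finite_sets (Y : topologicalType) :
  countable_fan_tightness_finite_sets Y -> countable_fan_tightness Y.
Proof.
move=> tY y C yC.
have [n|D [DC [_ Dy]]] := tY y (fun n => [set [set c] | c in C n]).
  have [clC nC] := yC n; split; last by move=> _ [c _ <-]; exact: finite_set1.
  split=> [_ [c _ <-]|N /clC [c [Cc Nc]]]; first by exists c.
  by exists [set c]; [exists c|move=> _ ->].
exists (fun n => \bigcup_(F in D n) F); split.
  move=> n; have [fD DnC] := DC n; split.
    by apply: bigcup_finite => // F /DnC [c _ <-]; exact: finite_set1.
  by move=> x [F /DnC [c Cc <-]] ->.
split.
  move=> N /Dy [F [n _ DnF] FN].
  have [c _ cF] := (DC n).2 _ DnF.
  have Fc : F c by rewrite -cF.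
  by exists c; split; [exists n => //; exists F|exact: FN].
move=> [n _ [F /(DC n).2 [c Cc <-] yc]].
by apply: (yC n).2; rewrite yc.
Qed.

Lemma open_finite_close (R : realType) (X : topologicalType) (B : set (set X))
    (f : CB R B) (F : set (CB R B)) (e : R) : finite_set F ->
  open [set x : X | forall g, F g ->
    `|(f : continuousType X R) x - (g : continuousType X R) x| < e].
Proof.
move=> fF.
rewrite (_ : [set x | _] = ~` \bigcup_(g in F) [set x |
   e <= `|(f : continuousType X R) x - (g : continuousType X R) x|]); last first.
  apply/seteqP; split=> [x H [g Fg /=]|x H g Fg].
    by rewrite leNgt H.
  by rewrite ltNge; apply/negP => le; apply: H; exists g.
rewrite openC; apply: closed_bigcup => // g Fg.
apply: (@preimage_closed _ _ (fun x =>
  `|(f : continuousType X R) x - (g : continuousType X R) x|) [set t | e <= t]);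
  last exact: closed_ge.
move=> x _; apply: (@cvg_norm _ R^o); apply: (@cvgB _ R^o); exact: cts_fun.
Qed.

Lemma Sfin_bcovers_of_fan_tightness (R : realType) (X : topologicalType)
    (B : set (set X)) :
  [set: X] !=set0 -> completely_regular_space X -> bornology B ->
  has_compact_base B -> countable_fan_tightness (CB R B) ->
  S_fin (open_bcovers B) (open_bcovers B).
Proof.
move=> X0 crX bB [B0 [B0B B0base] B0K] tC U cU.
have c0 : continuous (fun _ : X => 0 : R) by move=> x; exact: cvg_cst.
pose zero : CB R B := mkcts c0.
pose val (g : CB R B) : X -> R := (g : continuousType X R).
(* [zero] is not in [C n]: it equals [1] off [W] only if [W] is [X]. *)
pose C n := [set g : CB R B |
  exists2 W, U n W & forall x, ~ W x -> val g x = 1].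
have [n|V [VC [clV _]]] := tC zero C.
  have [Uo UT Ucov] := cU n; split.
    move=> N /(CB_nbhsP _ _ bB X0) [A [e [BA e0 AN]]].
    have [K BK AK] := B0base _ BA.
    have [W UW KW] := Ucov _ (B0B _ BK).
    have [g [cg g01 ge g1]] :=
      compact_open_bump crX (B0K _ BK) (Uo _ UW) KW e0.
    exists (mkcts cg : CB R B); split; first by exists W.
    apply: AN => x /AK /ge gxe.
    rewrite /= /mkcts sub0r normrN ger0_norm//.
    by have /andP[] := g01 x.
  move=> [W UW W0]; apply: UT.
  rewrite (_ : [set: X] = W)//; apply/seteqP; split=> // x _.
  apply: contrapT => /W0 /eqP.
  by rewrite /val /= /mkcts eq_sym oner_eq0.
have /choice [phi phiP] (p : nat * CB R B) : exists W, V p.1 p.2 ->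
    U p.1 W /\ forall x, ~ W x -> val p.2 x = 1.
  case: p => n g /=.
  have [Vng|nV] := pselect (V n g); last by exists set0.
  by have [W UW Wg] := (VC n).2 _ Vng; exists W.
exists (fun n => [set phi (n, g) | g in V n]); split.
  move=> n; split; first by apply: finite_image; exact: (VC n).1.
  by move=> _ [g Vng <-]; exact: (phiP (n, g) Vng).1.
split.
- move=> _ [n _ [g Vng <-]]; have [+ _ _] := cU n; apply.
  exact: (phiP (n, g) Vng).1.
- move=> [n _ [g Vng gT]]; have [_ + _] := cU n; apply.
  by rewrite -gT; exact: (phiP (n, g) Vng).1.
- move=> A BA.
  have [|g [[n _ Vng] gA]] :=
      clV [set g | forall x, A x -> `|val zero x - val g x| < 1].
    by apply/(CB_nbhsP _ _ bB X0); exists A, 1; split.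
  exists (phi (n, g)); first by exists n => //; exists g.
  move=> x /gA /=; apply: contraPP => /(phiP (n, g) Vng).2 /= ->.
  by rewrite /val /= /mkcts sub0r normrN normr1 ltxx.
Qed.

Lemma finite_fan_tightness_of_Sfin_bcovers (R : realType) (X : topologicalType)
    (B : set (set X)) :
  [set: X] !=set0 -> bornology B ->
  S_fin (open_bcovers B) (open_bcovers B) ->
  countable_fan_tightness_finite_sets (CB R B).
Proof.
move=> X0 bB SX f C netC.
pose val (g : CB R B) : X -> R := (g : continuousType X R).
pose close n (F : set (CB R B)) :=
  [set x | forall g, F g -> `|val f x - val g x| < n.+1%:R^-1].
pose U n := close n @` C n.
have Ucov n A : B A -> exists2 W, U n W & A `<=` W.
  move=> BA; have [[_ netn] _] := netC n.
  have [|F CF FA] :=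
      netn [set g | forall x, A x -> `|val f x - val g x| < n.+1%:R^-1].
    apply/(CB_nbhsP _ _ bB X0); exists A, n.+1%:R^-1.
    by split=> //; rewrite invr_gt0.
  exists (close n F); first by exists F.
  by move=> x Ax g /FA; apply.
have /choice [phi phiP] (p : nat * set X) : exists F, U p.1 p.2 ->
    C p.1 F /\ close p.1 F = p.2.
  case: p => n W /=.
  have [[F CF FW]|nU] := pselect (U n W); first by exists F.
  by exists set0.
(* It suffices to select covering sets at arbitrarily late stages, so that
   the radius drops below any given [e]. *)
suff [V [fV Vcov]] : exists V : nat -> set (set X),
    (forall n, finite_set (V n)) /\ forall A M, B A ->
    exists n W, [/\ (M <= n)%N, V n W, U n W & A `<=` W].
  exists (fun n => [set phi (n, W) | W in V n] `&` C n); split.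
    move=> n; split; last by move=> F [].
    by apply: finite_setIl; apply: finite_image.
  split=> [F [n _ [_ CF]]|N /(CB_nbhsP _ _ bB X0) [A [e [BA e0 AN]]]].
    by have [[+ _] _] := netC n; apply.
  have [M _ Me] := near_infty_natSinv_lt (PosNum e0).
  have [n [W [Mn VW UW AW]]] := Vcov A M BA.
  have /= [CF FW] := phiP (n, W) UW.
  exists (phi (n, W)); first by exists n => //; split => //; exists W.
  move=> g Fg; apply: AN => x /AW; rewrite -FW => /(_ g Fg) /lt_trans; apply.
  exact: Me.
(* If [X] itself occurs infinitely often, it is selected at every stage; the
   condition [U n W] above drops the stages where it does not occur. *)
have [full|] := pselect (forall N, exists2 n, (N <= n)%N & U n [set: X]).
  exists (fun=> [set setT]); split=> [n|A M BA]; first exact: finite_set1.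
  by have [n Mn UT] := full M; exists n, setT.
move=> /existsNP [N nfull].
(* Repeating the stage [N] in place of the earlier ones removes [X] from the
   families without shifting the indices. *)
have cU n : open_bcovers B (U (maxn N n)).
  split.
  - move=> _ [F CF <-]; apply: open_finite_close.
    by have [_ +] := netC (maxn N n); apply.
  - by move=> UT; apply: nfull; exists (maxn N n) => //; exact: leq_maxl.
  - exact: Ucov.
have [V [VU cV]] := SX _ cU.
exists V; split=> [n|A M BA]; first exact: (VU n).1.
have [n [W [+ VW AW]]] := bcover_tail (maxn N M) bB (fun n => (VU n).1) cV BA.
rewrite geq_max => /andP[Nn Mn].
by exists n, W; split=> //; rewrite -(maxn_idPr Nn); exact: (VU n).2.
Qed.

Lemma Sfin_bcovers_empty (X : topologicalType) (B : set (set X)) :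
  ~ ([set: X] !=set0) -> bornology B ->
  S_fin (open_bcovers B) (open_bcovers B).
Proof.
move=> X0 bB U cU.
(* In the empty space every set is [X], so a bornology has no member and the
   empty family is a cover. *)
have allT (W : set X) : W = setT.
  by apply/seteqP; split=> x //; case: X0; exists x.
exists (fun=> set0); split; first by move=> n; split=> //; exact: finite_set0.
rewrite bigcup0//; split=> // A BA.
by case: (bornologyNT bB); rewrite -(allT A).
Qed.

Lemma finite_fan_tightness_subsingleton (Y : topologicalType) :
  (forall y z : Y, y = z) -> countable_fan_tightness_finite_sets Y.
Proof.
move=> Y1 y C netC; exists (fun n => C n `&` [set [set y]]); split.
  by move=> n; split; [apply: finite_setIr; exact: finite_set1|move=> ? []].
split=> [F [n _ [_ ->]]|N /nbhs_singleton Ny]; first by exists y.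
have [[Cn0 /(_ setT filterT)[F CF _]] _] := netC 0%N.
have [z Fz] := Cn0 _ CF.
have Fy : F = [set y].
  by apply/seteqP; split=> x; rewrite (Y1 x z) // => _; exact: Y1.
by exists F; [exists 0%N|rewrite Fy => _ ->].
Qed.

Theorem theorem5p11 (R : realType) (X : topologicalType) (B : set (set X)) :
  tychonoff_space X -> bornology B -> has_compact_base B ->
  [<-> S_fin (open_bcovers B) (open_bcovers B);
       countable_fan_tightness (CB R B);
       countable_fan_tightness_finite_sets (CB R B)].
Proof.
move=> [_ crX] bB kB.
have Sfin_finite : S_fin (open_bcovers B) (open_bcovers B) ->
    countable_fan_tightness_finite_sets (CB R B).
  have [X0|X0] := pselect ([set: X] !=set0).
    exact: finite_fan_tightness_of_Sfin_bcovers.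
  move=> _; apply: finite_fan_tightness_subsingleton => f g.
  by apply/continuousEP => x; case: X0; exists x.
have tight_Sfin : countable_fan_tightness (CB R B) ->
    S_fin (open_bcovers B) (open_bcovers B).
  have [X0|X0] := pselect ([set: X] !=set0).
    exact: Sfin_bcovers_of_fan_tightness.
  by move=> _; exact: Sfin_bcovers_empty.
split; first by move=> /Sfin_finite/fan_tightness_of_finite_sets.
by split=> [/tight_Sfin/Sfin_finite|/fan_tightness_of_finite_sets/tight_Sfin].
Qed.
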